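(* Let $\delta\in(0,1)$. For each $n$, suppose that among $n$ workers exactly $\lceil n^\delta\rceil$ have ability $p_i^*=1$ and the remaining ones have ability $p_i^*=1/2$, and let $\hat y$ be the majority voting estimator for $m$ items with true labels $y^*\in\{0,1\}^m$. Then, as $n\to\infty$: - if $\delta\in(1/2,1)$, then $\frac1m\sum_{j\in[m]}\mathbb E|\hat y_j-y_j^*|=o(1)$; - if $\delta=1/2$, then $\frac1m\sum_{j\in[m]}\mathbb E|\hat y_j-y_j^*|=\Phi(-1)+o(1)$, where $\Phi$ is the cumulative distribution function of $N(0,1)$; - if $\delta\in(0,1/2)$, then $\frac1m\sum_{j\in[m]}\mathbb E|\hat y_j-y_j^*|=\frac12+o(1)$. Here $o(1)$ denotes a quantity converging to $0$ as $n\to\infty$.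
   Context: $[k]=\{1,\dots,k\}$. Model: worker $i\in[n]$ has ability $p_i^*\in[0,1]$, item $j\in[m]$ has true label $y_j^*\in\{0,1\}$; the observations $X_{ij}\in\{0,1\}$ are independent with $\mathbb P(X_{ij}=y_j^* )=p_i^*$ and $\mathbb P(X_{ij}=1-y_j^* )=1-p_i^*$. The majority voting estimator is $\hat y_j=\mathbb I\{\sum_{i\in[n]}X_{ij}\ge n/2\}$ for $j\in[m]$. *)

(* Defs.v *)
From HB Require Import structures.
From mathcomp Require Import all_boot all_order all_algebra.
From mathcomp Require Import all_classical all_reals all_analysis.

Set Implicit Arguments.
Unset Strict Implicit.
Unset Printing Implicit Defensive.

Import Order.TTheory GRing.Theory Num.Theory.
Import numFieldNormedType.Exports.

Local Open Scope classical_set_scope.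
Local Open Scope ring_scope.

Definition mutually_independent d (T : measurableType d) d'
    (T' : measurableType d') (R : realType) (P : probability T R)
    (I : finType) (X : I -> {RV P >-> T'}) : Prop :=
  forall (J : {set I}) (A : I -> set T'),
    (forall i, i \in J -> measurable (A i)) ->
    P (\bigcap_(i in [set` J]) X i @^-1` A i)
      = (\prod_(i in J) P (X i @^-1` A i))%E.

(* Labels in {0,1} are booleans, with [true] for 1; [~~ y j] is 1 - y j. *)
Record crowdsourcing_model d (T : measurableType d) (R : realType)
    (P : probability T R) (n m : nat) (p : 'I_n -> R) (y : 'I_m -> bool)
    (X : 'I_n -> 'I_m -> {RV P >-> bool}) : Prop := CrowdsourcingModel {
  ability_itv : forall i, 0 <= p i <= 1;
  observations_independent :
    mutually_independent (fun ij : 'I_n * 'I_m => X ij.1 ij.2);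
  prob_correct : forall i j, P [set t | X i j t = y j] = (p i)%:E;
  prob_wrong : forall i j, P [set t | X i j t = ~~ y j] = (1 - p i)%:E
}.

Definition majority_vote (R : realType) (n m : nat)
    (x : 'I_n -> 'I_m -> bool) (j : 'I_m) : bool :=
  n%:R / 2 <= \sum_(i < n) (x i j)%:R :> R.

Definition majority_vote_error d (T : measurableType d) (R : realType)
    (P : probability T R) (n m : nat) (y : 'I_m -> bool)
    (X : 'I_n -> 'I_m -> {RV P >-> bool}) : \bar R :=
  ((m%:R^-1)%:E * \sum_(j < m)
    'E_P[fun t => `|(majority_vote R (fun i k => X i k t) j)%:R
                    - (y j)%:R|%R])%E.

Definition std_normal_cdf (R : realType) (x : R) : \bar R :=
  normal_prob 0 1 `]-oo, x].

(* Main.v *)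
Require Import Defs.
From HB Require Import structures.
From mathcomp Require Import all_boot all_order all_algebra.
From mathcomp Require Import all_classical all_reals all_analysis.
From mathcomp Require Import measurable_realfun.
From mathcomp Require Import ring lra zify.

Set Implicit Arguments.
Unset Strict Implicit.
Unset Printing Implicit Defensive.

Import Order.TTheory GRing.Theory Num.Theory.
Import numFieldNormedType.Exports.

Local Open Scope classical_set_scope.
Local Open Scope ring_scope.

(** A worker of ability 1 never errs and a worker of ability 1/2 errs by a fair
    coin flip, so the set of workers wrong on an item is uniform among the subsets
    of the [N = n - ceil (n^delta)] fair workers, and majority voting errs exactly
    when that set has at least (about) [n/2] elements: the error is an upper tail
    of the binomial law [B(N, 1/2)].  De Moivre-Laplace gives the limit of this tail.
    Stirling's formula is avoided: the ratios of the binomial coefficients to the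
    central one are squeezed between Gaussian bounds, their sums are integrals of
    step functions that converge by dominated convergence, and the central
    coefficient is recovered from the fact that the upper half of the law has
    mass about 1/2. *)

(** * Symmetric binomial coefficients *)

(** The mass that the law B(N, 1/2) gives to the integers at least [a]; the sum is empty, hence 0,
    when [a > N]. *)
Definition upper_tail (R : realType) (N a : nat) : R :=
  (\sum_(a <= j < N.+1) 'C(N, j))%:R / 2 ^+ N.

Definition central_bin (R : realType) (N : nat) : R :=
  'C(N, uphalf N)%:R / 2 ^+ N.

(** Offsets are counted from [uphalf N], where the coefficient is maximal for both parities; the
    ratio vanishes once [uphalf N + l > N]. *)
Definition bin_ratio (R : realType) (N l : nat) : R :=
  'C(N, uphalf N + l)%:R / 'C(N, uphalf N)%:R.

Section SymmetricBinomial.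
Variable R : realType.
Implicit Types N a b l L : nat.

Lemma uphalf_bounds N : (N <= (uphalf N).*2 <= N.+1)%N.
Proof. by lia. Qed.

Lemma bin_central_gt0 N : (0 < 'C(N, uphalf N))%N.
Proof. by rewrite bin_gt0; lia. Qed.

Lemma bin_ratio0 N : bin_ratio R N 0 = 1.
Proof. by rewrite /bin_ratio addn0 divff// pnatr_eq0 -lt0n bin_central_gt0. Qed.

Lemma bin_ratio_ge0 N l : 0 <= bin_ratio R N l.
Proof. by rewrite divr_ge0. Qed.

Lemma bin_ratioS N l : bin_ratio R N l.+1 =
  bin_ratio R N l * ((N - (uphalf N + l))%N%:R / (uphalf N + l).+1%:R).
Proof.
rewrite /bin_ratio addnS.
have C0 : 'C(N, uphalf N)%:R != 0 :> R by rewrite pnatr_eq0 -lt0n bin_central_gt0.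
have := mul_bin_left N (uphalf N + l).
move=> /(congr1 (fun k => k%:R : R)); rewrite !natrM => E.
have S0 : (uphalf N + l).+1%:R != 0 :> R by rewrite pnatr_eq0.
apply: (mulfI S0); rewrite mulrA E [RHS]mulrCA [X in _ = _ * X]mulrCA mulfV//.
by rewrite mulr1 [RHS]mulrC mulrA.
Qed.

(** With [h = uphalf N], [N <= 2h] bounds the factor of [bin_ratioS] by [1 - (2l+1)/(h+l+1)], hence
    by [exp(-(2l+1)/(h+L))]; the odd numbers add up to [l^2]. The auxiliary [L] keeps the
    denominator fixed along the induction. *)
Lemma bin_ratio_le_expR N l L : (l <= L)%N ->
  bin_ratio R N l <= expR (- (l%:R ^+ 2 / (uphalf N + L)%:R)).
Proof.
elim: l => [|l IH] lL; first by rewrite bin_ratio0 expr0n/= mul0r oppr0 expR0.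
set h := uphalf N in IH *.
have hL0 : 0 < (h + L)%N%:R :> R by rewrite ltr0n; lia.
have hl0 : 0 < (h + l).+1%:R :> R by rewrite ltr0n.
rewrite bin_ratioS -/h.
(* From [N <= h + l] on, the truncated subtraction makes the factor 0. *)
have [Nhl|hlN] := leqP N (h + l).
  by rewrite (eqP (_ : (N - (h + l))%N == 0%N)) ?mul0r ?mulr0 ?expR_ge0// subn_eq0.
have -> : - (l.+1%:R ^+ 2 / (h + L)%N%:R : R) =
    - (l%:R ^+ 2 / (h + L)%N%:R) + - ((2 * l + 1)%N%:R / (h + L)%N%:R).
  move: ((_ + _)%N%:R : R) hL0 => D D0.
  by rewrite -[l.+1%:R]natr1 natrD natrM; field; rewrite lt0r_neq0.
rewrite expRD; apply: ler_pM => //.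
- exact: bin_ratio_ge0.
- by apply: IH; lia.
apply: (le_trans _ (expR_ge1Dx _)).
apply: (@le_trans _ _ (1 - (2 * l + 1)%N%:R / (h + l).+1%:R)); last first.
  rewrite lerB// ler_pM2l ?ltr0n; last by lia.
  by rewrite lef_pV2// ler_nat; lia.
rewrite ler_pdivrMr// mulrBl mul1r divfK ?gt_eqF//.
by rewrite lerBrDr -natrD ler_nat; rewrite /h; lia.
Qed.

(** Here [2h <= N + 1] bounds the inverse of each factor by [1 + (2l+2)/(N-h-l)], hence by
    [exp((2l+2)/(h-L))]; the even numbers add up to [l^2 + l]. *)
Lemma expR_le_bin_ratio N l L : (l <= L < uphalf N)%N ->
  expR (- ((l%:R ^+ 2 + l%:R) / (uphalf N - L)%:R)) <= bin_ratio R N l.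
Proof.
elim: l => [|l IH] lL.
  by rewrite bin_ratio0 expr0n/= addr0 mul0r oppr0 expR0.
set h := uphalf N in IH lL *.
have hL0 : 0 < (h - L)%N%:R :> R by rewrite ltr0n; lia.
have hl0 : 0 < (h + l).+1%:R :> R by rewrite ltr0n.
have Nl0 : 0 < (N - (h + l))%N%:R :> R by rewrite ltr0n /h; lia.
rewrite bin_ratioS -/h.
have -> : - ((l.+1%:R ^+ 2 + l.+1%:R) / (h - L)%N%:R : R) =
    - ((l%:R ^+ 2 + l%:R) / (h - L)%N%:R) + - ((2 * l + 2)%N%:R / (h - L)%N%:R).
  move: ((_ - _)%N%:R : R) hL0 => D D0.
  by rewrite -[l.+1%:R]natr1 natrD natrM; field; rewrite lt0r_neq0.
rewrite expRD; apply: ler_pM => //; try exact: expR_ge0.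
  by apply: IH; lia.
(* Inverting both sides turns the lower bound into an upper one, which [1 + x <= exp x] provides. *)
rewrite expRN -[leRHS]invrK lef_pV2 ?posrE ?invr_gt0 ?divr_gt0 ?expR_gt0//.
apply: (le_trans _ (expR_ge1Dx _)); rewrite invf_div.
apply: (@le_trans _ _ (1 + (2 * l + 2)%N%:R / (N - (h + l))%N%:R)); last first.
  rewrite lerD2l ler_pM2l ?ltr0n; last by lia.
  by rewrite lef_pV2// ler_nat /h; lia.
rewrite ler_pdivrMr// mulrDl mul1r divfK ?gt_eqF//.
by rewrite -natrD ler_nat /h; lia.
Qed.

Lemma upper_tail_shift N b : upper_tail R N (uphalf N + b) =
  central_bin R N * \sum_(b <= l < N.+1) bin_ratio R N l.
Proof.
rewrite /upper_tail /central_bin /bin_ratio -mulr_suml.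
have C0 : 'C(N, uphalf N)%:R != 0 :> R by rewrite pnatr_eq0 -lt0n bin_central_gt0.
rewrite [RHS]mulrC -[RHS]mulrA [X in _ = _ * X]mulrA mulVf// mul1r.
rewrite -natr_sum; congr (_%:R / _).
have [bN|Nb] := leqP (uphalf N + b) N.+1; last first.
  rewrite big_geq ?(ltnW Nb)// big_nat big1// => l bl.
  by rewrite bin_small//; lia.
(* The offsets from [N.+1 - uphalf N] on contribute vanishing coefficients. *)
rewrite [RHS](@big_cat_nat _ _ _ (N.+1 - uphalf N)%N)/=; [|lia..].
rewrite [X in _ = (_ + X)%N]big_nat [X in _ = (_ + X)%N]big1 ?addn0; last first.
  by move=> l hl; rewrite bin_small//; lia.
by rewrite addnC big_addn; apply: eq_bigr => l _; rewrite addnC.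
Qed.

Lemma upper_tail_antitone N a b : (a <= b)%N -> upper_tail R N b <= upper_tail R N a.
Proof.
move=> ab; rewrite ler_pM2r ?invr_gt0 ?exprn_gt0// ler_nat.
have [bN|Nb] := leqP b N.+1; last by rewrite [leqLHS]big_geq// ltnW.
by rewrite [leqRHS](big_cat_nat ab bN) /= leq_addl.
Qed.

(** The reflection [j -> N - j] sends the indices below [h = uphalf N] to those above [N - h]. These
    are the upper half itself for odd [N], and the upper half without [h] for even [N], so the two
    halves differ by at most the central term. *)
Lemma upper_tail_half_bounds N :
  1 / 2 <= upper_tail R N (uphalf N) <= 1 / 2 + central_bin R N.
Proof.
rewrite /upper_tail /central_bin; set h := uphalf N.
pose S := (\sum_(h <= j < N.+1) 'C(N, j))%N.
pose S' := (\sum_(0 <= j < h) 'C(N, j))%N.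
have ES : (S' + S = 2 ^ N)%N.
  rewrite -big_cat_nat//=; last by rewrite /h; lia.
  rewrite big_mkord -[RHS]/((1 + 1) ^ N)%N expnDn.
  by apply: eq_bigr => i _; rewrite !exp1n !muln1.
have ES' : S' = (\sum_((N - h).+1 <= j < N.+1) 'C(N, j))%N.
  rewrite /S' big_nat_rev/= add0n -[(N - h).+1]add0n big_addn.
  rewrite (_ : N.+1 - (N - h).+1 = h)%N; last by rewrite /h; lia.
  rewrite big_nat [RHS]big_nat; apply: eq_bigr => j hj.
  by rewrite -bin_sub; [congr ('C(_, _)); rewrite /h in hj *; lia|lia].
have SS : (S' <= S <= S' + 'C(N, h))%N.
  rewrite ES' /S; apply/andP; split.
    by rewrite [leqRHS](@big_cat_nat _ _ _ (N - h).+1)/= ?leq_addl// /h; lia.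
  rewrite big_ltn; last by rewrite /h; lia.
  rewrite addnC leq_add2r [leqRHS](@big_cat_nat _ _ _ h.+1)/= ?leq_addl// /h; lia.
rewrite -/S.
have E2 : (S' + S)%:R = 2 ^+ N :> R by rewrite ES natrX.
have P2 : 0 < 2 ^+ N :> R by rewrite exprn_gt0.
rewrite ler_pdivlMr// ler_pdivrMr//.
rewrite mulrDl mul1r divfK ?gt_eqF// -E2.
by move: SS => /andP[]; rewrite -!(ler_nat R) !natrD; lra.
Qed.

End SymmetricBinomial.

(** * Integrals of step functions *)

Section StepIntegral.
Variable R : realType.
Notation mu := (@lebesgue_measure R).
Variables (s : R) (f : nat -> R) (K : nat).
Hypotheses (s0 : 0 < s) (f0 : forall l, 0 <= f l).
Hypothesis fK : forall l, (K <= l)%N -> f l = 0.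

Lemma truncn_step_sum x : 0 <= x -> f (Num.truncn (x * s)) =
  \sum_(l < K) f l * \1_(`[l%:R / s, l.+1%:R / s[) x.
Proof.
move=> x0; have xs0 : 0 <= x * s by rewrite mulr_ge0// ltW.
have E l : (l%:R / s <= x < l.+1%:R / s) = (Num.truncn (x * s) == l).
  by rewrite truncn_eq// ler_pdivrMr// ltr_pdivlMr.
set t := Num.truncn _ in E *.
have ind l : \1_(`[l%:R / s, l.+1%:R / s[) x = (t == l)%:R :> R.
  by rewrite indicE mem_setE in_itv/= E.
under eq_bigr do rewrite ind.
have [tK|Kt] := ltnP t K.
  rewrite (bigD1 (Ordinal tK))//= eqxx mulr1 big1 ?addr0// => i it.
  by rewrite eq_sym (negbTE (_ : (i : nat) != t)) ?mulr0.
rewrite fK// big1// => i _.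
by rewrite gtn_eqF ?mulr0//; exact: leq_trans Kt.
Qed.

Let mterm l : measurable_fun (`[0, +oo[ : set R)
  (EFin \o (fun x => f l * \1_(`[l%:R / s, l.+1%:R / s[) x)).
Proof.
apply/measurable_EFinP; apply: measurable_funM => //.
Qed.

Let step_sumE x : (`[0, +oo[ : set R)%classic x ->
  (f (Num.truncn (x * s)))%:E =
  (\sum_(l <- index_enum 'I_K) (f l * \1_(`[l%:R / s, l.+1%:R / s[) x)%:E)%E.
Proof.
by rewrite /= in_itv/= andbT => x0; rewrite truncn_step_sum// sumEFin.
Qed.

Lemma measurable_truncn_step :
  measurable_fun (`[0, +oo[ : set R) (EFin \o (fun x => f (Num.truncn (x * s)))).
Proof.
apply: (eq_measurable_fun (fun x : R => (\sum_(l <- index_enum 'I_K)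
   (f l * \1_(`[l%:R / s, l.+1%:R / s[) x)%:E)%E)).
  by move=> x; rewrite inE => x0; rewrite /= step_sumE.
by apply: emeasurable_sum => l; exact: mterm.
Qed.

(** Each value [f l] is taken on a cell of length [1/s]. Sums whose range grows with [n] thus become
    integrals over one fixed half-line. *)
Lemma integral_truncn_step :
  (\int[mu]_(x in `[0%R, +oo[) (f (Num.truncn (x * s)))%:E)%E =
  (s^-1 * \sum_(l < K) f l)%:E.
Proof.
under eq_integral => x.
  rewrite inE => x0; rewrite step_sumE//; over.
rewrite ge0_integral_sum//; last 2 first.
  by move=> l; exact: mterm.
  by move=> l x _; rewrite lee_fin mulr_ge0// indicE.
rewrite mulr_sumr -sumEFin; apply: eq_bigr => l _.
under eq_integral do rewrite EFinM.
rewrite ge0_integralZl//; last by rewrite lee_fin.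
  rewrite integral_indic//= setIidl; last first.
    move=> x /=; rewrite !in_itv/= andbT => /andP[+ _]; apply: le_trans.
    by rewrite divr_ge0// ltW.
  rewrite lebesgue_measure_itv/= lte_fin ltr_pM2r ?invr_gt0// ltr_nat ltnSn.
  rewrite -EFinB -mulrBl -natrB// subSnn mul1r -EFinM mulrC//.
by apply/measurable_EFinP; exact: measurable_indic.
Qed.

End StepIntegral.


(** * De Moivre-Laplace limit *)

(** The standard deviation of B(n, 1/2). It also serves as the scale for B(N n, 1/2), since
    [N n / n] tends to 1. *)
Definition half_sqrt (R : realType) (n : nat) : R := Num.sqrt n%:R / 2.

Lemma half_sqrt_gt0 (R : realType) n : (0 < n)%N -> 0 < half_sqrt R n.
Proof. by move=> n0; rewrite divr_gt0// sqrtr_gt0 ltr0n. Qed.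

Lemma half_sqrtX2 (R : realType) n : half_sqrt R n ^+ 2 = n%:R / 4.
Proof. by rewrite /half_sqrt exprMn sqr_sqrtr// exprVn -natrX. Qed.

Lemma natV_cvg0 (R : realType) : (n%:R^-1 : R) @[n --> \oo] --> (0 : R).
Proof.
apply/gtr0_cvgV0; last exact: cvgr_idn.
by near=> n; rewrite ltr0n; near: n; exact: nbhs_infty_gt.
Unshelve. all: by end_near. Qed.

Lemma half_sqrtV_cvg0 (R : realType) : (half_sqrt R n)^-1 @[n --> \oo] --> (0 : R).
Proof.
have -> : (fun n => (half_sqrt R n)^-1) = (fun n => 2 * Num.sqrt n%:R^-1).
  by apply/funext => n; rewrite /half_sqrt invf_div sqrtrV.
rewrite -(mulr0 2) -(@sqrtr0 R); apply: cvgM; first exact: cvg_cst.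
apply: (@continuous_cvg _ R R \oo _ (fun n => n%:R^-1) Num.sqrt 0).
  exact: sqrt_continuous.
exact: natV_cvg0.
Qed.

(** * Gaussian limit of the binomial ratios *)

Section LocalLimit.
Variable R : realType.
Variables (N : nat -> nat).
Hypothesis N_lim : ((N n)%:R / n%:R : R) @[n --> \oo] --> (1 : R).
Local Notation s := (half_sqrt R).

Lemma uphalf_scale_cvg : ((uphalf (N n))%:R / s n ^+ 2) @[n --> \oo] --> (2 : R).
Proof.
have lim2 : ((2 : R) * ((N n)%:R / n%:R)) @[n --> \oo] --> (2 : R).
  by rewrite -[X in _ --> X]mulr1; apply: cvgM => //; exact: cvg_cst.
have lim2' : ((2 : R) * ((N n)%:R / n%:R) + 2 * n%:R^-1) @[n --> \oo] --> (2 : R).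
  rewrite -[X in _ --> X]addr0; apply: cvgD => //.
  by rewrite -(mulr0 2); apply: cvgM; [exact: cvg_cst|exact: natV_cvg0].
apply: (squeeze_cvgr _ lim2 lim2').
near=> n; have n0 : (0 < n)%N by near: n; exact: nbhs_infty_gt.
have nR0 : 0 < n%:R :> R by rewrite ltr0n.
rewrite half_sqrtX2 invf_div !mulrA -mulrDl.
have /andP[] := uphalf_bounds (N n).
rewrite -!(ler_nat R) -muln2 natrM -natr1 => h1 h2.
by rewrite !ler_pM2r ?invr_gt0//; lra.
Unshelve. all: by end_near. Qed.

Lemma truncn_scale_cvg (x : R) : 0 <= x ->
  ((Num.truncn (x * s n))%:R / s n) @[n --> \oo] --> x.
Proof.
move=> x0; have limx : (x - (s n)^-1) @[n --> \oo] --> x.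
  rewrite -[X in _ --> X]subr0.
  by apply: cvgB; [exact: cvg_cst|exact: half_sqrtV_cvg0].
apply: (squeeze_cvgr _ limx (cvg_cst x)).
near=> n; have s0 : 0 < s n by apply: half_sqrt_gt0; near: n; exact: nbhs_infty_gt.
have /andP[tl tu] := truncn_itv (mulr_ge0 x0 (ltW s0)).
rewrite ler_pdivrMr// ler_pdivlMr// tl andbT mulrBl mulVf ?gt_eqF//.
by rewrite lerBlDr natr1 ltW.
Unshelve. all: by end_near. Qed.

(** Both exponential bounds are taken with [L = l]. After division by [s^2] their exponents involve
    only [l/s -> x], [h/s^2 -> 2] and [l/s^2 -> 0], so both tend to [-x^2/2]. *)
Lemma bin_ratio_cvg (x : R) : 0 <= x ->
  bin_ratio R (N n) (Num.truncn (x * s n)) @[n --> \oo] --> expR (- (x ^+ 2 / 2)).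
Proof.
move=> x0; pose l n := Num.truncn (x * s n); pose h n := uphalf (N n).
have lim_l : ((l n)%:R / s n) @[n --> \oo] --> x := truncn_scale_cvg x0.
have lim_l2 : ((l n)%:R / s n * (s n)^-1) @[n --> \oo] --> (0 : R).
  by rewrite -(mulr0 x); apply: cvgM => //; exact: half_sqrtV_cvg0.
have lim_h : ((h n)%:R / s n ^+ 2) @[n --> \oo] --> (2 : R) := uphalf_scale_cvg.
have lim_u : expR (- (((l n)%:R / s n) ^+ 2 /
    ((h n)%:R / s n ^+ 2 + (l n)%:R / s n * (s n)^-1)))
    @[n --> \oo] --> expR (- (x ^+ 2 / 2)).
  apply: continuous_cvg; first exact: continuous_expR.
  apply: cvgN; apply: cvgM.
    apply: (@continuous_cvg _ R R \oo _ _ (fun y => y ^+ 2) x) lim_l.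
    exact: exprn_continuous.
  by apply: cvgV => //; rewrite -[X in _ --> X]addr0; exact: cvgD.
have lim_d : ((h n)%:R / s n ^+ 2 - (l n)%:R / s n * (s n)^-1) @[n --> \oo] --> (2 : R).
  by rewrite -[X in _ --> X]subr0; exact: cvgB.
have lim_v : expR (- ((((l n)%:R / s n) ^+ 2 + (l n)%:R / s n * (s n)^-1) /
    ((h n)%:R / s n ^+ 2 - (l n)%:R / s n * (s n)^-1)))
    @[n --> \oo] --> expR (- (x ^+ 2 / 2)).
  apply: continuous_cvg; first exact: continuous_expR.
  apply: cvgN; apply: cvgM.
    rewrite -[X in _ --> X]addr0; apply: cvgD => //.
    apply: (@continuous_cvg _ R R \oo _ _ (fun y => y ^+ 2) x) lim_l.
    exact: exprn_continuous.
  by apply: cvgV => //; rewrite -[X in _ --> X]addr0; exact: cvgD.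
apply: (squeeze_cvgr _ lim_v lim_u).
near=> n; have s0 : 0 < s n by apply: half_sqrt_gt0; near: n; exact: nbhs_infty_gt.
have sn0 : s n != 0 by rewrite gt_eqF.
(* The limit of this difference is 2; its eventual positivity yields [l n < h n], the side condition
   of the lower bound. *)
have d0 : 0 < (h n)%:R / s n ^+ 2 - (l n)%:R / s n * (s n)^-1.
  by near: n; apply: (cvgr_gt _ lim_d).
have E : (l n)%:R / s n * (s n)^-1 = (l n)%:R / s n ^+ 2.
  by rewrite -mulrA -invfM -expr2.
have lh : (l n < h n)%N.
  by move: d0; rewrite E -mulrBl pmulr_lgt0 ?invr_gt0 ?exprn_gt0// subr_gt0 ltr_nat.
have E2 (a b : R) : (a / s n ^+ 2) / (b / s n ^+ 2) = a / b.
  by rewrite invf_div mulrA divfK ?expf_neq0.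
rewrite E expr_div_n -mulrDl -mulrBl -mulrDl !E2.
apply/andP; split.
  have := @expR_le_bin_ratio R (N n) (l n) (l n).
  by rewrite leqnn lh natrB ?(ltnW lh)//; exact.
by have := @bin_ratio_le_expR R (N n) (l n) (l n) (leqnn _); rewrite natrD.
Unshelve. all: by end_near. Qed.

End LocalLimit.

(** The choice [L = n] gives a denominator [uphalf N + n <= 2n]; for [l > n] the ratio is 0. *)
Lemma bin_ratio_le_gauss (R : realType) N n l : (N <= n)%N ->
  bin_ratio R N l <= expR (- (l%:R ^+ 2 / (2 * n%:R))).
Proof.
move=> Nn; have [ln|nl] := leqP l n; last first.
  by rewrite /bin_ratio bin_small ?mul0r ?expR_ge0//; lia.
apply: (le_trans (bin_ratio_le_expR R N ln)); rewrite ler_expR lerN2.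
have [->|l0] := posnP l; first by rewrite expr0n/= !mul0r.
rewrite ler_pM2l ?exprn_gt0 ?ltr0n// -natrM lef_pV2 ?posrE ?ltr0n ?ler_nat; lia.
Qed.

(** An integrable bound independent of [n], for dominated convergence. It is a multiple of an
    exponential density, equal to [exp(1 - x/4)]. *)
Lemma bin_ratio_truncn_le (R : realType) N n x : (0 < n)%N -> (N <= n)%N -> 0 <= x ->
  bin_ratio R N (Num.truncn (x * half_sqrt R n)) <=
  4 * expR 1 * exponential_pdf (1 / 4) x.
Proof.
move=> n0 Nn x0; apply: (le_trans (bin_ratio_le_gauss R _ Nn)).
set l := Num.truncn _; rewrite exponential_pdfE//.
have s0 := @half_sqrt_gt0 R n n0.
pose u := l%:R / half_sqrt R n.
have -> : l%:R ^+ 2 / (2 * n%:R) = u ^+ 2 / 8.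
  rewrite /u expr_div_n half_sqrtX2; field.
  by rewrite pnatr_eq0 -lt0n n0.
have -> : 4 * expR 1 * (1 / 4 * expR (- (1 / 4) * x)) = expR (1 - x / 4).
  by rewrite [- (1 / 4) * x](_ : _ = - (x / 4)) ?expRD; [field|lra].
rewrite ler_expR.
(* Truncation loses less than [1/s], and [s >= 1/2]. *)
have xu : x - 2 <= u.
  have /andP[_ lx] := truncn_itv (mulr_ge0 x0 (ltW s0)).
  have s12 : 1 / 2 <= half_sqrt R n.
    by rewrite /half_sqrt ler_pM2r ?invr_gt0// -[leLHS]sqrtr1 ler_wsqrtr// ler1n.
  rewrite /u ler_pdivlMr// mulrBl; rewrite -natr1 -/l in lx.
  by apply: le_trans (_ : x * half_sqrt R n - 1 <= _); lra.
(* The tangent bound [u^2 >= 2u - 1] gives [u^2/8 >= (2x - 5)/8 >= x/4 - 1]. *)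
by have := sqr_ge0 (u - 1); rewrite sqrrB expr1n mulr1; lra.
Qed.

(** * Limits of the scaled tail sums *)

Section TailLimit.
Variable R : realType.
Notation mu := (@lebesgue_measure R).
Variables (N : nat -> nat).
Hypothesis N_lim : ((N n)%:R / n%:R : R) @[n --> \oo] --> (1 : R).
Hypothesis N_le : forall n, (N n <= n)%N.
Local Notation s := (half_sqrt R).

Let J (D : set R) : \bar R :=
  (\int[mu]_(x in `[0%R, +oo[) ((EFin \o normal_fun 0 1) \_ D) x)%E.

Definition scaled_tail (b : nat -> nat) (n : nat) : R :=
  (s n)^-1 * \sum_(b n <= l < (N n).+1) bin_ratio R (N n) l.

(** The hypothesis says that the rescaled cutoffs [x >= b n / s n] converge almost everywhere to
    membership in [D]. A general [D] covers a finite limit [c] of the cutoff ([[c, +oo[]) as well as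
    an infinite one (the empty set). *)
Lemma scaled_tail_cvg (b : nat -> nat) (D : set R) : measurable D ->
  {ae mu, forall x, 0 <= x -> \forall n \near \oo, ((b n)%:R / s n <= x) = (x \in D)} ->
  (scaled_tail b n)%:E @[n --> \oo] --> J D.
Proof.
move=> mD hb.
pose r n l : R := if (b n <= l)%N then bin_ratio R (N n) l else 0.
have r0 n l : 0 <= r n l by rewrite /r; case: ifP => // _; exact: bin_ratio_ge0.
have rK n l : ((N n).+1 <= l)%N -> r n l = 0.
  by move=> Nl; rewrite /r; case: ifP => // _; rewrite /bin_ratio bin_small ?mul0r//; lia.
have E n : (0 < n)%N -> (scaled_tail b n)%:E =
    (\int[mu]_(x in `[0%R, +oo[) (r n (Num.truncn (x * s n)))%:E)%E.
  move=> n0; rewrite (integral_truncn_step (half_sqrt_gt0 R n0) (r0 n) (rK n)).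
  rewrite /scaled_tail big_geq_mkord/= -big_mkcond/=; congr (_ * _)%:E.
(* At index 0 the scale [half_sqrt] vanishes and the step function is not
   integrable, so domination only holds from index 1 on. *)
rewrite -cvg_shiftS/=.
under eq_cvg do rewrite E//.
have [] // := @dominated_convergence _ _ R mu `[0%R, +oo[%classic _
  (fun n x => (r n.+1 (Num.truncn (x * s n.+1)))%:E)
  ((EFin \o normal_fun 0 1) \_ D)
  (fun x => (4 * expR 1)%:E * (exponential_pdf (1 / 4) x)%:E)%E.
- move=> n; exact: (measurable_truncn_step (half_sqrt_gt0 R (ltn0Sn n)) (rK n.+1)).
- apply: measurable_funTS; apply/(measurable_restrictT _ mD); apply: measurable_funTS.
  by apply/measurable_EFinP; exact: measurable_normal_fun.
- apply: (@filterS _ _ (ae_filter_ringOfSetsType mu) _ _ _ hb) => x hx.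
  rewrite /= in_itv/= andbT => x0.
  rewrite (cvg_shiftS (fun n => (r n (Num.truncn (x * s n)))%:E)).
  (* For a positive scale, [b n <= truncn (x * s n)] amounts to [b n / s n <= x], whose truth value
     is eventually that of [x \in D]. *)
  have rE : \forall n \near \oo, r n (Num.truncn (x * s n)) =
      if x \in D then bin_ratio R (N n) (Num.truncn (x * s n)) else 0.
    near=> n; have s0 : 0 < s n by apply: half_sqrt_gt0; near: n; exact: nbhs_infty_gt.
    rewrite /r truncn_ge_nat ?mulr_ge0 ?(ltW s0)// -ler_pdivrMr//.
    by rewrite (_ : (_ <= x) = (x \in D))//; near: n; exact: hx.
  rewrite patchE; case: ifPn => xD; last first.
    have c0 : (0%E : \bar R) @[_ --> \oo] --> (0%E : \bar R) by exact: cvg_cst.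
    apply: cvg_trans c0.
    by apply: near_eq_cvg; apply: filterS rE => n /= ->; rewrite (negbTE xD).
  have -> : (EFin \o normal_fun 0 1) x = (expR (- (x ^+ 2 / 2)))%:E.
    by rewrite /= /normal_fun subr0 expr1n mulNr.
  apply: cvg_EFin; first by near=> n.
  apply: cvg_trans (bin_ratio_cvg N_lim x0).
  by apply: near_eq_cvg; apply: filterS rE => n /= ->; rewrite xD.
- apply: integrableZl => //; apply: integrableS (integrable_exponential_pdf _) => //.
- apply: aeW => x n; rewrite /= in_itv/= andbT => x0.
  rewrite ger0_norm// -EFinM lee_fin.
  apply: le_trans (bin_ratio_truncn_le (ltn0Sn n) (N_le n.+1) x0).
  by rewrite /r; case: ifP => // _; exact: bin_ratio_ge0.
Unshelve. all: by end_near. Qed.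

End TailLimit.

(** * Half-line masses of the standard normal law *)

Section NormalTail.
Variable R : realType.
Notation mu := (@lebesgue_measure R).

Lemma normal_pdf01_even (x : R) : normal_pdf 0 1 (- x) = normal_pdf 0 1 x :> R.
Proof. by rewrite !normal_pdfE// /normal_fun !subr0 sqrrN. Qed.

Lemma std_normal_cdfN (c : R) : std_normal_cdf (- c) = normal_prob 0 1 `[c, +oo[.
Proof.
rewrite /std_normal_cdf /normal_prob ge0_integration_by_substitutionNy.
- by apply: eq_integral => x _ /=; rewrite normal_pdf01_even.
- by apply: continuous_subspaceT => x; exact: continuous_normal_pdf.
- by move=> x _; exact: normal_pdf_ge0.
Qed.

(** The density is even and has total mass 1. *)
Lemma normal_prob_ge0_half : normal_prob 0 1 (`[0, +oo[ : set R) = (1 / 2)%:E.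
Proof.
have := @integral_normal_pdf R 0 1.
rewrite ge0_symfun_integralT; last 3 first.
- by move=> x; exact: normal_pdf_ge0.
- exact: continuous_normal_pdf.
- by move=> x /=; rewrite normal_pdf01_even.
rewrite (_ : [set x | _] = `[0, +oo[%classic); last first.
  by apply/seteqP; split => x/=; rewrite in_itv/= andbT.
rewrite -/(normal_prob 0 1 _) => h.
have : normal_prob 0 1 (`[0, +oo[ : set R) \is a fin_num by exact: fin_num_measure.
move: h; case: (normal_prob 0 1 _) => // r; rewrite -EFinM => -[h] _.
by congr (_%:E); lra.
Qed.

(** Supplies the normalising constant that is absent from the limit of [scaled_tail]. *)
Lemma normal_prob_nonneg_subset (D : set R) : measurable D -> D `<=` `[0, +oo[ ->
  (normal_prob 0 1 D = (normal_peak 1)%:E *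
    \int[mu]_(x in `[0%R, +oo[) ((EFin \o normal_fun 0 1) \_ D) x)%E.
Proof.
move=> mD D0; rewrite -integral_mkcondr setIidr// -ge0_integralZl//.
- by apply: eq_integral => x _; rewrite normal_pdfE.
- by apply/measurable_EFinP; apply: measurable_funTS; exact: measurable_normal_fun.
- by move=> x _; rewrite lee_fin normal_fun_ge0.
- by rewrite lee_fin normal_peak_ge0.
Qed.

End NormalTail.

(** * Central coefficient and limit of the binomial tails *)

Section DeMoivreLaplace.
Variable R : realType.
Notation mu := (@lebesgue_measure R).
Variables (N : nat -> nat).
Hypothesis N_lim : ((N n)%:R / n%:R : R) @[n --> \oo] --> (1 : R).
Hypothesis N_le : forall n, (N n <= n)%N.
Local Notation s := (half_sqrt R).
Local Notation peak := (normal_peak 1 : R).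

Lemma scaled_tail_normal_cvg (b : nat -> nat) (D : set R) :
  measurable D -> D `<=` `[0, +oo[ ->
  {ae mu, forall x, 0 <= x -> \forall n \near \oo, ((b n)%:R / s n <= x) = (x \in D)} ->
  peak * scaled_tail R N b n @[n --> \oo] --> fine (normal_prob 0 1 D).
Proof.
move=> mD D0 hb.
apply: (@fine_cvg _ _ _ _ (fun n => (peak * scaled_tail R N b n)%:E)).
rewrite fineK; last exact: fin_num_measure.
rewrite normal_prob_nonneg_subset//.
under eq_cvg do rewrite EFinM.
by apply: cvgeZl => //; exact: scaled_tail_cvg.
Qed.

Lemma scaled_tail0_cvg : peak * scaled_tail R N (fun=> 0) n @[n --> \oo] --> (1 / 2 : R).
Proof.
rewrite (_ : 1 / 2 = fine (normal_prob 0 1 (`[0, +oo[ : set R))); last first.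
  by rewrite normal_prob_ge0_half.
apply: scaled_tail_normal_cvg => //; apply: aeW => x x0.
by apply: nearW => n; rewrite mul0r x0 mem_setE in_itv/= x0.
Qed.

(* The bounds of [upper_tail_half_bounds] force [B n] to converge to 1. *)
Let B n := central_bin R (N n) * s n / peak.

Let peak0 : 0 < peak. Proof. exact: normal_peak_gt0. Qed.

Let tailE b n : (0 < n)%N ->
  upper_tail R (N n) (uphalf (N n) + b n) = B n * (peak * scaled_tail R N b n).
Proof.
move=> n0; rewrite upper_tail_shift /B /scaled_tail mulrA divfK ?gt_eqF//.
by rewrite -[RHS]mulrA [s n * _]mulrA divff ?mul1r// gt_eqF// half_sqrt_gt0.
Qed.

Let B_cvg : B n @[n --> \oo] --> (1 : R).
Proof.
have lim_t := scaled_tail0_cvg.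
set t := (fun n => _) in lim_t.
have lim_d : (t n - peak * (s n)^-1) @[n --> \oo] --> (1 / 2 : R).
  rewrite -[X in _ --> X]subr0; apply: cvgB => //; rewrite -[X in _ --> X](mulr0 peak).
  by apply: cvgM; [exact: cvg_cst|exact: half_sqrtV_cvg0].
have half0 : 1 / 2 != 0 :> R by rewrite div1r invr_eq0 pnatr_eq0.
(* The half-mass bounds read [1/2 <= B t <= 1/2 + B peak / s], that is,
   [1/(2t) <= B <= 1/(2(t - peak/s))]. Both ends tend to 1 because [t -> 1/2] and [1/s -> 0]. *)
have low : ((2 : R)^-1 * (t n)^-1) @[n --> \oo] --> (1 : R).
  rewrite [X in _ --> X](_ : 1 = 2^-1 * (1 / 2)^-1); last by field.
  by apply: cvgM; [exact: cvg_cst|exact: (cvgV half0 lim_t)].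
have upp : ((2 : R)^-1 * (t n - peak * (s n)^-1)^-1) @[n --> \oo] --> (1 : R).
  rewrite [X in _ --> X](_ : 1 = 2^-1 * (1 / 2)^-1); last by field.
  by apply: cvgM; [exact: cvg_cst|exact: (cvgV half0 lim_d)].
apply: (squeeze_cvgr _ low upp).
near=> n.
have n0 : (0 < n)%N by near: n; exact: nbhs_infty_gt.
have t0 : 0 < t n by near: n; apply: (cvgr_gt _ lim_t).
have d0 : 0 < t n - peak * (s n)^-1 by near: n; apply: (cvgr_gt _ lim_d).
have := upper_tail_half_bounds R (N n).
have -> : upper_tail R (N n) (uphalf (N n)) = B n * t n.
  by rewrite -(@tailE (fun=> 0%N))// addn0.
have -> : central_bin R (N n) = B n * (peak * (s n)^-1).
  by rewrite /B mulrA divfK ?gt_eqF// mulfK// gt_eqF// half_sqrt_gt0.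
move=> /andP[h1 h2].
by rewrite ler_pdivrMr// ler_pdivlMr// mulrBr; apply/andP; split; lra.
Unshelve. all: by end_near. Qed.

Lemma upper_tail_cvg (b : nat -> nat) (D : set R) :
  measurable D -> D `<=` `[0, +oo[ ->
  {ae mu, forall x, 0 <= x -> \forall n \near \oo, ((b n)%:R / s n <= x) = (x \in D)} ->
  upper_tail R (N n) (uphalf (N n) + b n) @[n --> \oo] --> fine (normal_prob 0 1 D).
Proof.
move=> mD D0 hb; rewrite -[X in _ --> X]mul1r.
apply: cvg_trans (cvgM B_cvg (scaled_tail_normal_cvg mD D0 hb)).
apply: near_eq_cvg; near=> n; rewrite /= tailE//.
by near: n; exact: nbhs_infty_gt.
Unshelve. all: by end_near. Qed.

End DeMoivreLaplace.

(** * Error probability of majority voting *)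

Section FairWorkers.
Variables (R : realType) (n : nat).
Implicit Types A F : {set 'I_n}.

Lemma card_large_subsets F (a : nat) :
  (\sum_(A : {set 'I_n} | (A \subset F) && (a <= #|A|)) 1 =
   \sum_(a <= k < #|F|.+1) 'C(#|F|, k))%N.
Proof.
rewrite big_geq_mkord /=.
(* Subsets are grouped by cardinality; [inord] is faithful here because a subset of [F] has at most
   [#|F|] elements. *)
rewrite (partition_big (fun A : {set 'I_n} => inord #|A| : 'I_#|F|.+1)
  (fun k : 'I_#|F|.+1 => (a <= k)%N)) /=; last first.
  by move=> A /andP[/subset_leq_card AF aA]; rewrite inordK.
apply: eq_bigr => k ak; rewrite sum1dep_card -(cards_draws F k).
apply: eq_card => A; rewrite !inE; apply/andP/andP => -[].
  move=> /andP[AF aA] /eqP Ak; split=> //.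
  by rewrite -Ak inordK// ltnS subset_leq_card.
move=> AF /eqP Ak; rewrite AF Ak ak; split=> //.
by apply/eqP/val_inj; rewrite /= inordK// -Ak ltnS subset_leq_card.
Qed.

(** A worker of ability 1 contributes 0 if in [A] and 1 otherwise, while a fair worker contributes
    1/2 in either case. *)
Lemma prod_fair_workers (p : 'I_n -> R) A :
  (forall i, p i != 1 -> p i = 1 / 2) ->
  \prod_i (if i \in A then 1 - p i else p i) =
  (A \subset [set i | p i != 1]%SET)%:R * 2 ^- #|[set i | p i != 1]%SET|.
Proof.
move=> hp.
case: (boolP (A \subset _)) => [/fintype.subsetP AF|/fintype.subsetPn[i iA]]; last first.
  rewrite inE negbK => /eqP pi1; rewrite mul0r.
  by rewrite (bigD1 i)//= iA pi1 subrr mul0r.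
rewrite mul1r -exprVn -prodr_const [RHS]big_mkcond/=; apply: eq_bigr => i _.
rewrite inE; have [pi1|/hp ->] := eqVneq (p i) 1.
  by case: ifPn => // /AF; rewrite inE pi1 eqxx.
by case: ifP => _ /=; lra.
Qed.

Lemma sum_fair_workers (p : 'I_n -> R) (a : nat) :
  (forall i, p i != 1 -> p i = 1 / 2) ->
  \sum_(A : {set 'I_n} | (a <= #|A|)%N) \prod_i (if i \in A then 1 - p i else p i) =
  upper_tail R #|[set i | p i != 1]%SET| a.
Proof.
move=> hp; rewrite /upper_tail -card_large_subsets natr_sum mulr_suml.
rewrite big_mkcond [RHS]big_mkcond/=; apply: eq_bigr => A _.
rewrite prod_fair_workers//.
by case: (A \subset _); case: ifP => _; rewrite ?mul1r ?mul0r.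
Qed.

End FairWorkers.

(** A tie is decided in favour of label 1. For true label 1 an error therefore takes strictly more
    than [n/2] wrong votes, whereas for label 0 [n/2] of them suffice. *)
Lemma majority_vote_errE (R : realType) (n m : nat) (x : 'I_n -> 'I_m -> bool)
    (j : 'I_m) (b : bool) :
  (majority_vote R x j != b) =
  ((if b then n./2.+1 else uphalf n) <= #|[set i | x i j != b]%SET|)%N.
Proof.
rewrite /majority_vote.
have -> : \sum_(i < n) (x i j)%:R = #|[set i | x i j]%SET|%:R :> R.
  rewrite -sum1_card natr_sum [RHS]big_mkcond/=; apply: eq_bigr => i _.
  by rewrite inE; case: (x i j).
rewrite ler_pdivrMr// -natrM ler_nat.
case: b.
  have -> : [set i | x i j != true]%SET = ~: [set i | x i j]%SET.
    by apply/setP => i; rewrite !inE eqb_id.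
  rewrite [in RHS]cardsCs finset.setCK card_ord.
  by have := max_card (mem [set i | x i j]%SET); rewrite card_ord; lia.
have -> : [set i | x i j != false]%SET = [set i | x i j]%SET.
  by apply/setP => i; rewrite !inE eqbF_neg negbK.
by lia.
Qed.

Section ErrorProbability.
Context d (T : measurableType d) (R : realType) (P : probability T R).
Variables (n m : nat) (p : 'I_n -> R) (y : 'I_m -> bool).
Variable X : 'I_n -> 'I_m -> {RV P >-> bool}.
Hypothesis model : crowdsourcing_model p y X.

Let mistakes (j : 'I_m) (A : {set 'I_n}) : set T :=
  [set t | [set i | X i j t != y j]%SET = A].

(** Fixing the exact set of wrong workers prescribes every observation in column [j], which puts the
    event in the form required by independence. The prescribed value [(i \in A) (+) y j] is the
    wrong label exactly when [i \in A]. *)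
Let mistakesE j A : mistakes j A =
  \bigcap_(ij in [set` [set ij : 'I_n * 'I_m | ij.2 == j]%SET])
    X ij.1 ij.2 @^-1` [set (ij.1 \in A) (+) y j].
Proof.
apply/seteqP; split => t /=.
  move=> <- [i k] /=; rewrite inE => /eqP/= ->; rewrite inE.
  by case: (X i j t); case: (y j).
move=> h; apply/setP => i; rewrite inE.
have /= -> : X i j t = (i \in A) (+) y j by apply: (h (i, j)); rewrite /= inE.
by case: (i \in A); case: (y j).
Qed.

Let measurable_mistakes j A : measurable (mistakes j A).
Proof.
rewrite mistakesE; apply: fin_bigcap_measurable => // ij _.
by rewrite -[X in measurable X]setTI; exact: measurable_funP.
Qed.

Let prob_mistakes j A :
  P (mistakes j A) = (\prod_i (if i \in A then 1 - p i else p i))%:E.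
Proof.
have [_ ind pc pw] := model.
rewrite mistakesE (ind _ (fun ij => [set (ij.1 \in A) (+) y j])) => //.
rewrite -prodEFin.
rewrite (reindex_onto (fun i : 'I_n => (i, j)) fst) /=; last first.
  by move=> [i k]; rewrite inE => /eqP/= ->.
apply: eq_big => [i|i _]; first by rewrite inE !eqxx.
case: (i \in A).
  by rewrite addTb -(pw i j); congr (P _).
by rewrite addFb -(pc i j); congr (P _).
Qed.

(** The error indicator is the sum of the indicators of the disjoint events [mistakes j A] over all
    [A] with at least [a] elements; integrating termwise leaves a sum over subsets of the fair
    workers. *)
Lemma expected_error_tail (j : 'I_m) : (forall i, p i != 1 -> p i = 1 / 2) ->
  'E_P[fun t => `|(majority_vote R (fun i k => X i k t) j)%:R - (y j)%:R|%R]%E =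
  (upper_tail R #|[set i | p i != 1]%SET| (if y j then n./2.+1 else uphalf n))%:E.
Proof.
move=> hp; set a := if _ then _ else _.
rewrite unlock.
have E t : `|(majority_vote R (fun i k => X i k t) j)%:R - (y j)%:R| =
    \sum_(A : {set 'I_n} | (a <= #|A|)%N) \1_(mistakes j A) t :> R.
  transitivity ((majority_vote R (fun i k => X i k t) j != y j)%:R : R).
    case: (majority_vote _ _ _); case: (y j);
      rewrite ?subrr ?subr0 ?sub0r ?normrN ?normr0 ?normr1//.
  rewrite majority_vote_errE -/a.
  set A0 := [set i | X i j t != y j]%SET.
  have ind A : \1_(mistakes j A) t = (A0 == A)%:R :> R.
    by rewrite indicE; congr ((nat_of_bool _)%:R); apply/idP/eqP; rewrite inE.
  under eq_bigr do rewrite ind.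
  rewrite big_mkcond (bigD1 A0)//= eqxx big1 ?addr0//.
    by case: ifP.
  by move=> A AA; rewrite eq_sym (negbTE AA); case: ifP.
under eq_integral do rewrite E -sumEFin -big_filter.
rewrite -sum_fair_workers// ge0_integral_sum//.
- rewrite big_filter -sumEFin; apply: eq_bigr => A _.
  rewrite integral_indic// classical_sets.setIT; exact: prob_mistakes.
- by move=> A; apply/measurable_EFinP; exact: measurable_indic.
Qed.

End ErrorProbability.

(** * Asymptotics of the error *)

Section PowerLimits.
Variable R : realType.

Lemma natr_powR_cvgy (a : R) : 0 < a -> n%:R `^ a @[n --> \oo] --> +oo.
Proof.
move=> a0; apply/cvgryPge => A; near=> n.
have : `|A| `^ a^-1 <= n%:R by near: n; exact: nbhs_infty_ger.
move=> /(ge0_ler_powR (ltW a0)); rewrite !nnegrE powR_ge0 ler0n => /(_ isT isT).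
rewrite -powRrM mulVf ?gt_eqF// powRr1//; apply: le_trans; exact: ler_norm.
Unshelve. all: by end_near. Qed.

Lemma natr_powR_cvg0 (a : R) : a < 0 -> n%:R `^ a @[n --> \oo] --> (0 : R).
Proof.
move=> a0; rewrite -[a]opprK.
under eq_cvg do rewrite powRN.
apply/gtr0_cvgV0; last by apply: natr_powR_cvgy; rewrite oppr_gt0.
near=> n; apply: powR_gt0; rewrite ltr0n.
by near: n; exact: nbhs_infty_gt.
Unshelve. all: by end_near. Qed.

(** Only at [x = c] can the comparison with [u n] fail to settle, and a single point is
    negligible. *)
Lemma ae_le_cvg (u : nat -> R) (c : R) : u n @[n --> \oo] --> c ->
  {ae (@lebesgue_measure R), forall x, 0 <= x ->
    \forall n \near \oo, (u n <= x) = (x \in `[c, +oo[%classic)}.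
Proof.
move=> uc; exists [set c]; split => //; first exact: lebesgue_measure_set1.
move=> x /= hx; apply: contrapT => /eqP xNc; apply: hx => _.
have [xc|cx] := ltP x c.
  have h : \forall n \near \oo, x < u n by apply: (cvgr_gt _ uc).
  apply: filterS h => n xu.
  by rewrite leNgt xu mem_setE in_itv/= andbT leNgt xc.
have {}cx : c < x by rewrite lt_neqAle cx eq_sym xNc.
have h : \forall n \near \oo, u n < x by apply: (cvgr_lt _ uc).
by apply: filterS h => n ux; rewrite (ltW ux) mem_setE in_itv/= andbT (ltW cx).
Qed.

(** This is where the critical exponent 1/2 appears: the [n^delta] reliable workers are compared
    with fluctuations of order [sqrt n]. *)
Lemma powR_div_half_sqrt (a : R) n : (0 < n)%N ->
  n%:R `^ a / half_sqrt R n = 2 * n%:R `^ (a - 1 / 2).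
Proof.
move=> n0; rewrite /half_sqrt invf_div mulrCA; congr (_ * _).
by rewrite powRB ?pnatr_eq0 -?lt0n ?n0 ?implybT// div1r powR12_sqrt.
Qed.

End PowerLimits.

Section ErrorLimit.
Variables (R : realType) (delta : R) (K : nat -> nat).
Hypothesis delta01 : 0 < delta < 1.
Hypothesis K_le : forall n, (K n <= n)%N.
Hypothesis K_itv : forall n, n%:R `^ delta <= (K n)%:R < n%:R `^ delta + 1.

Let N n := (n - K n)%N.
Local Notation s := (half_sqrt R).

Let N_le n : (N n <= n)%N. Proof. exact: leq_subr. Qed.

(** At most [n^delta + 1] workers are removed, which is negligible against [n] because
    [delta < 1]. *)
Let N_cvg : ((N n)%:R / n%:R : R) @[n --> \oo] --> (1 : R).
Proof.
have d1 : delta - 1 < 0 by case/andP: delta01 => _; lra.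
have low : (1 - (n%:R `^ (delta - 1) + n%:R^-1) : R) @[n --> \oo] --> (1 : R).
  rewrite -[X in _ --> X]subr0; apply: cvgB; first exact: cvg_cst.
  rewrite -[X in _ --> X](addr0 0); apply: cvgD; last exact: natV_cvg0.
  exact: natr_powR_cvg0.
apply: (squeeze_cvgr _ low (cvg_cst (1 : R))).
near=> n; have n0 : (0 < n)%N by near: n; exact: nbhs_infty_gt.
have nR0 : 0 < n%:R :> R by rewrite ltr0n.
rewrite ler_pdivrMr// mul1r ler_nat N_le andbT ler_pdivlMr//.
have -> : n%:R `^ (delta - 1) = n%:R `^ delta / n%:R :> R.
  by rewrite powRB ?powRr1// pnatr_eq0 -lt0n n0 implybT.
rewrite mulrBl mulrDl divfK ?gt_eqF// mulVf ?gt_eqF// natrB//.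
by have /andP[_] := K_itv n; lra.
Unshelve. all: by end_near. Qed.

Section Offset.
Variable b : nat -> nat.
(** The offset of the threshold [n/2] from the centre [N/2] is [K/2], about [n^delta / 2]; the
    constants absorb the rounding of both halves and of [K]. *)
Hypothesis b_itv : forall n, n%:R `^ delta - 1 <= 2 * (b n)%:R <= n%:R `^ delta + 3.

Let low n := n%:R `^ (delta - 1 / 2) - (s n)^-1 / 2 : R.
Let upp n := n%:R `^ (delta - 1 / 2) + (s n)^-1 * (3 / 2) : R.

Let b_scaled n : (0 < n)%N -> low n <= (b n)%:R / s n <= upp n.
Proof.
move=> n0; have s0 := half_sqrt_gt0 R n0.
have E : n%:R `^ (delta - 1 / 2) * s n = n%:R `^ delta / 2.
  rewrite (canRL (divfK (lt0r_neq0 s0)) (powR_div_half_sqrt delta n0)).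
  by rewrite -[X in _ = X / _]mulrA [RHS]mulrC mulKf.
rewrite /low /upp ler_pdivlMr// ler_pdivrMr// mulrBl mulrDl E.
rewrite [(s n)^-1 / 2 * _]mulrAC [(s n)^-1 * (3 / 2) * _]mulrAC mulVf ?gt_eqF//.
by have /andP[b1 b2] := b_itv n; apply/andP; split; lra.
Qed.

Let s_cvg c : (s n)^-1 * c @[n --> \oo] --> (0 : R).
Proof.
rewrite -[X in _ --> X](mul0r c).
by apply: cvgM; [exact: half_sqrtV_cvg0|exact: cvg_cst].
Qed.

Lemma offset_cvg c : n%:R `^ (delta - 1 / 2) @[n --> \oo] --> (c : R) -> 0 <= c ->
  upper_tail R (N n) (uphalf (N n) + b n) @[n --> \oo] -->
    fine (normal_prob 0 1 (`[c, +oo[ : set R)).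
Proof.
move=> lim_c c0; apply: upper_tail_cvg => //.
  move=> x /=; rewrite !in_itv/= !andbT; exact: le_trans.
apply: (@ae_le_cvg R (fun n => (b n)%:R / s n)).
have lim_low : low n @[n --> \oo] --> (c : R).
  by rewrite -[X in _ --> X]subr0; apply: cvgB => //; exact: s_cvg.
have lim_upp : upp n @[n --> \oo] --> (c : R).
  by rewrite -[X in _ --> X]addr0; apply: cvgD => //; exact: s_cvg.
apply: (squeeze_cvgr _ lim_low lim_upp).
by near=> n; apply: b_scaled; near: n; exact: nbhs_infty_gt.
Unshelve. all: by end_near. Qed.

(** The rescaled offset tends to infinity, so it eventually exceeds any fixed [x] and the limiting
    cutoff set is empty. *)
Lemma offset_cvgy : 1 / 2 < delta ->
  upper_tail R (N n) (uphalf (N n) + b n) @[n --> \oo] --> (0 : R).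
Proof.
move=> hd.
rewrite (_ : 0 = fine (normal_prob 0 1 (set0 : set R))); last by rewrite measure0.
apply: upper_tail_cvg => //.
apply: aeW => x x0; rewrite in_set0.
have lim : n%:R `^ (delta - 1 / 2) @[n --> \oo] --> +oo.
  by apply: natr_powR_cvgy; lra.
have lim_s : \forall n \near \oo, (s n)^-1 / 2 < 1.
  by apply: (cvgr_lt _ (s_cvg _)).
near=> n; apply/negbTE; rewrite -ltNge.
have n0 : (0 < n)%N by near: n; exact: nbhs_infty_gt.
have h1 : x + 1 <= n%:R `^ (delta - 1 / 2) by near: n; exact: (cvgryPge _).1.
have h2 : (s n)^-1 / 2 < 1 by near: n.
have /andP[+ _] := b_scaled n0; rewrite /low; lra.
Unshelve. all: by end_near. Qed.

Lemma offset_cvg_cases :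
  [/\ 1 / 2 < delta ->
        upper_tail R (N n) (uphalf (N n) + b n) @[n --> \oo] --> (0 : R),
      delta = 1 / 2 ->
        upper_tail R (N n) (uphalf (N n) + b n) @[n --> \oo] -->
          fine (std_normal_cdf (-1 : R))
    & delta < 1 / 2 ->
        upper_tail R (N n) (uphalf (N n) + b n) @[n --> \oo] --> (1 / 2 : R)].
Proof.
split=> [|hd|hd]; first exact: offset_cvgy.
- rewrite std_normal_cdfN; apply: offset_cvg => //.
  (* At the critical exponent the rescaled offset tends to [n^0 = 1], whence the tail from 1, of
     mass [Phi(-1)]. *)
  rewrite hd subrr; under eq_cvg do rewrite powRr0.
  exact: cvg_cst.
- rewrite (_ : 1 / 2 = fine (normal_prob 0 1 (`[0, +oo[ : set R))); last first.
    by rewrite normal_prob_ge0_half.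
  by apply: offset_cvg => //; apply: natr_powR_cvg0; lra.
Qed.

End Offset.

Lemma threshold_cvg_cases (a : nat -> nat) :
  (forall n, n <= (a n).*2 <= n.+2)%N ->
  [/\ 1 / 2 < delta -> upper_tail R (N n) (a n) @[n --> \oo] --> (0 : R),
      delta = 1 / 2 ->
        upper_tail R (N n) (a n) @[n --> \oo] --> fine (std_normal_cdf (-1 : R))
    & delta < 1 / 2 -> upper_tail R (N n) (a n) @[n --> \oo] --> (1 / 2 : R)].
Proof.
(* The subtraction does not truncate: [N n <= n <= 2 * a n] gives [uphalf (N n) <= a n]. *)
move=> ha; pose b n := (a n - uphalf (N n))%N.
have ab : a = (fun n => uphalf (N n) + b n)%N.
  by apply/funext => n; rewrite /b; have := ha n; have := N_le n; lia.
rewrite ab; apply: offset_cvg_cases => n.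
have /andP[K1 K2] := K_itv n.
have /andP[] : (K n <= (b n).*2.+1)%N && ((b n).*2 <= K n + 2)%N.
  by rewrite /b /N; have := ha n; have := K_le n; lia.
rewrite -!(ler_nat R) -addn1 natrD -muln2 natrM natrD => h1 h2.
by apply/andP; split; lra.
Qed.

End ErrorLimit.

(** The label of an item affects its expected error only through the threshold. The average over
    items thus lies between the tails at [n./2.+1] and [uphalf n], whatever the labels and their
    number. *)
Lemma majority_vote_error_cvg (R : realType)
    (m : nat -> nat) (y : forall n, 'I_(m n) -> bool) (p : forall n, 'I_n -> R)
    (d : nat -> measure_display) (T : forall n, measurableType (d n))
    (P : forall n, probability (T n) R)
    (X : forall n, 'I_n -> 'I_(m n) -> {RV P n >-> bool}) (l : R) :
  (forall n, (0 < m n)%N) ->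
  (forall n, crowdsourcing_model (p n) (y n) (X n)) ->
  (forall n i, p n i != 1 -> p n i = 1 / 2) ->
  upper_tail R #|[set i | p n i != 1]%SET| n./2.+1 @[n --> \oo] --> l ->
  upper_tail R #|[set i | p n i != 1]%SET| (uphalf n) @[n --> \oo] --> l ->
  majority_vote_error (y n) (X n) @[n --> \oo] --> l%:E.
Proof.
move=> hm hmodel hrest lim_low lim_upp.
pose F n := #|[set i | p n i != 1]%SET|.
pose e n := (m n)%:R^-1 *
  \sum_(j < m n) upper_tail R (F n) (if y n j then n./2.+1 else uphalf n).
have -> : (fun n => majority_vote_error (y n) (X n)) = (fun n => (e n)%:E).
  apply/funext => n; rewrite /majority_vote_error /e EFinM -sumEFin.
  congr (_ * _)%E; apply: eq_bigr => j _.
  exact: (expected_error_tail (hmodel n) j (hrest n)).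
apply: cvg_EFin; first by near=> n.
apply: (squeeze_cvgr _ lim_low lim_upp); apply: nearW => n /=.
have m0 : 0 < (m n)%:R :> R by rewrite ltr0n.
have half_le : (uphalf n <= n./2.+1)%N by lia.
rewrite /e mulrC ler_pdivlMr// ler_pdivrMr// !mulr_natr.
have sumE (c : R) : c *+ m n = \sum_(j < m n) c by rewrite sumr_const card_ord.
rewrite !sumE; apply/andP; split;
  apply: ler_sum => j _; apply: upper_tail_antitone; case: (y n j) => //.
Unshelve. all: by end_near. Qed.

Theorem theorem4p1 (R : realType) (delta : R)
    (m : nat -> nat) (y : forall n, 'I_(m n) -> bool)
    (p : forall n, 'I_n -> R)
    (d : nat -> measure_display) (T : forall n, measurableType (d n))
    (P : forall n, probability (T n) R)
    (X : forall n, 'I_n -> 'I_(m n) -> {RV P n >-> bool})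
    (hdelta : 0 < delta < 1)
    (hm : forall n, (0 < m n)%N)
    (hmodel : forall n, crowdsourcing_model (p n) (y n) (X n))
    (hcard : forall n,
      #|[set i | p n i == 1]%SET|%:Z = Num.ceil (n%:R `^ delta))
    (hrest : forall n i, p n i != 1 -> p n i = 1 / 2) :
  [/\ 1 / 2 < delta ->
        majority_vote_error (y n) (X n) @[n --> \oo] --> 0%E,
      delta = 1 / 2 ->
        majority_vote_error (y n) (X n) @[n --> \oo] --> std_normal_cdf (-1 : R)
    & delta < 1 / 2 ->
        majority_vote_error (y n) (X n) @[n --> \oo] --> (1 / 2)%:E].
Proof.
pose K n := #|[set i | p n i == 1]%SET|.
have fairE n : #|[set i | p n i != 1]%SET| = (n - K n)%N.
  have -> : [set i | p n i != 1]%SET = (~: [set i | p n i == 1])%SET.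
    by apply/setP => i; rewrite !inE.
  by rewrite cardsCs finset.setCK card_ord.
have K_le n : (K n <= n)%N by rewrite -[leqRHS]card_ord max_card.
have K_itv n : n%:R `^ delta <= (K n)%:R < n%:R `^ delta + 1.
  have /andP[] := ceil_itv (n%:R `^ delta).
  rewrite -hcard intrB -pmulrn ltrBlDr => h1 h2.
  by rewrite h2.
(* Both tie-breaking thresholds satisfy [n <= 2a <= n + 2], so their tails have the same limits. *)
have [low1 low2 low3] := threshold_cvg_cases hdelta K_le K_itv
  (a := fun n => n./2.+1) (fun n => ltac:(lia)).
have [upp1 upp2 upp3] := threshold_cvg_cases hdelta K_le K_itv
  (a := uphalf) (fun n => ltac:(lia)).
have err l : upper_tail R (n - K n) n./2.+1 @[n --> \oo] --> l ->
    upper_tail R (n - K n) (uphalf n) @[n --> \oo] --> l ->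
    majority_vote_error (y n) (X n) @[n --> \oo] --> l%:E.
  move=> hl hu; apply: (majority_vote_error_cvg hm hmodel hrest).
    by under eq_cvg do rewrite fairE.
  by under eq_cvg do rewrite fairE.
split=> hd.
- exact: err (low1 hd) (upp1 hd).
- rewrite -[X in _ --> X]fineK; first exact: err (low2 hd) (upp2 hd).
  exact: fin_num_measure.
- exact: err (low3 hd) (upp3 hd).
Qed.
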